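(* The $\text{R-FS}_{\varepsilon,\delta}$ algorithm is an instance of subgradient descent applied to the regularized correlation minimization problem $$\mathrm{RCM}_\delta:\quad \min_r\ f_\delta(r):=\|\mathbf{X}^Tr\|_\infty+\tfrac{1}{2\delta}\|r-\mathbf{y}\|_2^2\quad\text{s.t. } r\in P_{\mathrm{res}},$$ initialized at $\hat r^0=\mathbf{y}$, with constant step-size $\alpha_k:=\varepsilon$ at each iteration.
   Context: Standing data: $\mathbf{X}=[\mathbf{X}_1,\ldots,\mathbf{X}_p]\in\mathbb{R}^{n\times p}$ has columns with zero mean and unit $\ell_2$ norm, and $\mathbf{y}\in\mathbb{R}^n$ has zero mean. $P_{\mathrm{res}}:=\{r\in\mathbb{R}^n: r=\mathbf{y}-\mathbf{X}\beta\text{ for some }\beta\in\mathbb{R}^p\}$. $\mathrm{sgn}(a)\in\{-1,0,1\}$ is the sign of $a$, with $\mathrm{sgn}(0)=0$. $e_j$ is the $j$-th unit vector. Subgradient descent for minimizing a convex function $f$ over a closed convex set $P$: at iterate $x^k$, take a subgradient $g^k\in\partial f(x^k)$, i.e. a vector with $f(y)\ge f(x^k)+(g^k)^T(y-x^k)$ for all $y\in P$, and set $x^{k+1}=\Pi_P(x^k-\alpha_kg^k)$, where $\Pi_P$ is Euclidean projection onto $P$. An algorithm producing residuals $\hat r^k$ is ''an instance of subgradient descent with step-sizes $\alpha_k$'' applied to minimizing $f$ over $P_{\mathrm{res}}$ if $\hat r^0$ is the given initial point and for each $k$ there is $g^k\in\partial f(\hat r^k)$ with $\hat r^{k+1}=\Pi_{P_{\mathrm{res}}}(\hat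 r^k-\alpha_kg^k)$. Algorithm $\text{R-FS}_{\varepsilon,\delta}$, with learning rate $\varepsilon>0$ and regularization parameter $\delta>0$, $\varepsilon\le\delta$: initialize $\hat r^0=\mathbf{y}$, $\hat\beta^0=0$. For $k=0,1,\ldots$: choose any $j_k\in\arg\max_{j}|(\hat r^k)^T\mathbf{X}_j|$, set $\hat r^{k+1}=\hat r^k-\varepsilon\left[\mathrm{sgn}((\hat r^k)^T\mathbf{X}_{j_k})\mathbf{X}_{j_k}+\tfrac1\delta(\hat r^k-\mathbf{y})\right]$ and $\hat\beta^{k+1}=(1-\tfrac{\varepsilon}{\delta})\hat\beta^k+\varepsilon\,\mathrm{sgn}((\hat r^k)^T\mathbf{X}_{j_k})e_{j_k}$. *)

(* Defs.v *)
From mathcomp Require Import all_boot all_order all_algebra.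
From mathcomp Require Import all_classical all_reals all_analysis.

Set Implicit Arguments.
Unset Strict Implicit.
Unset Printing Implicit Defensive.

Import Order.TTheory GRing.Theory Num.Theory.
Import numFieldNormedType.Exports.

Local Open Scope classical_set_scope.
Local Open Scope ring_scope.

Section Vectors.
Variables (R : realType) (n : nat).
Implicit Types (u v : 'cV[R]_n).

Definition dotp u v : R := (u^T *m v) 0 0.

Definition vmean v : R := n%:R^-1 * \sum_i v i 0.

(* The library norm `|v| on 'cV[R]_n is the sup norm, hence a separate l2 norm. *)
Definition l2norm v : R := Num.sqrt (\sum_i v i 0 ^+ 2).

End Vectors.

Section SubgradientDescent.
Variables (R : realType) (n : nat).
Implicit Types (f : 'cV[R]_n -> R) (P : set 'cV[R]_n).

(* Relative to P: the inequality is required only at points of P, while the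
   subgradients themselves range over the whole space. *)
Definition subdifferential f P (x : 'cV[R]_n) : set 'cV[R]_n :=
  [set g | forall z, P z -> f z >= f x + dotp g (z - x)].

(* x is the unique nearest point of P to z.  A nearest point of a closed convex
   set exists and is unique, so there this is the graph of the projection. *)
Definition is_proj P (z x : 'cV[R]_n) : Prop :=
  P x /\ forall w, P w -> w <> x -> l2norm (z - x) < l2norm (z - w).

Definition subgradient_descent f P (alpha : nat -> R) (x0 : 'cV[R]_n)
    (x : nat -> 'cV[R]_n) : Prop :=
  x 0%N = x0 /\
  forall k, exists2 g, subdifferential f P (x k) g &
                       is_proj P (x k - alpha k *: g) (x k.+1).

End SubgradientDescent.

Section Regression.
Variables (R : realType) (n p : nat) (X : 'M[R]_(n, p)) (y : 'cV[R]_n).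

Definition P_res : set 'cV[R]_n := [set r | exists beta : 'cV[R]_p, r = y - X *m beta].

(* `|X^T *m r| is the l-infinity norm: the library norm on matrices is the
   maximum of the absolute values of the entries. *)
Definition RCM_obj (delta : R) (r : 'cV[R]_n) : R :=
  `|X^T *m r| + (2 * delta)^-1 * l2norm (r - y) ^+ 2.

(* (r, beta, j) is a run of R-FS with learning rate eps and regularization
   parameter delta; ties in the argmax are broken arbitrarily. *)
Record RFS_run (eps delta : R) (r : nat -> 'cV[R]_n) (beta : nat -> 'cV[R]_p)
    (j : nat -> 'I_p) : Prop := {
  RFS_r0 : r 0%N = y;
  RFS_beta0 : beta 0%N = 0;
  RFS_argmax : forall k i,
    `|dotp (r k) (col i X)| <= `|dotp (r k) (col (j k) X)|;
  RFS_rS : forall k,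
    r k.+1 = r k - eps *: (Num.sg (dotp (r k) (col (j k) X)) *: col (j k) X
                           + delta^-1 *: (r k - y));
  RFS_betaS : forall k,
    beta k.+1 = (1 - eps / delta) *: beta k
                + (eps * Num.sg (dotp (r k) (col (j k) X))) *: delta_mx (j k) 0
}.

End Regression.

(* Main.v *)
Require Import Defs.
From mathcomp Require Import all_boot all_order all_algebra.
From mathcomp Require Import all_classical all_reals all_analysis.
From mathcomp Require Import ring lra.

Set Implicit Arguments.
Unset Strict Implicit.
Unset Printing Implicit Defensive.

Import Order.TTheory GRing.Theory Num.Theory.
Import numFieldNormedType.Exports.

Local Open Scope classical_set_scope.
Local Open Scope ring_scope.

(** The update of R-FS is a subgradient step because its bracket
    [sgn (r^T X_j) X_j + (r - y) / delta] is a subgradient of [f_delta] at [r],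
    with one summand for each summand of [f_delta].  The map
    [r |-> norm_oo (X^T r)] is the maximum over [i] and over [s] in [{-1, 0, 1}]
    of the linear functions [s X_i^T r]; an index [j] of the argmax and the sign of the
    correlation pick one that attains this maximum at [r], and the gradient of
    such a function is a subgradient of the maximum
    ([subgradient_max_correlation]).  The quadratic summand contributes its
    gradient ([subgradient_sqr_dist]), and subgradients add up
    ([subdifferentialD]).

    The projection onto [P_res] never moves the point: the coefficient update
    mirrors the residual update, so that [r k = y - X (beta k)] throughout the
    run ([RFS_residual]).  Hence the point after each step is already in
    [P_res], where the projection is the identity ([is_proj_id]). *)

Section InnerProduct.
Variables (R : realType) (n : nat).
Implicit Types (u v w : 'cV[R]_n).

Lemma dotpE u v : dotp u v = \sum_i u i 0 * v i 0.
Proof. by rewrite /dotp mxE; apply: eq_bigr => i _; rewrite mxE. Qed.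

Lemma dotpC u v : dotp u v = dotp v u.
Proof. by rewrite !dotpE; apply: eq_bigr => i _; rewrite mulrC. Qed.

Lemma dotpDl u v w : dotp (u + v) w = dotp u w + dotp v w.
Proof. by rewrite /dotp linearD mulmxDl mxE. Qed.

Lemma dotpZl a u v : dotp (a *: u) v = a * dotp u v.
Proof. by rewrite /dotp linearZ -scalemxAl mxE. Qed.

Lemma dotpDr u v w : dotp u (v + w) = dotp u v + dotp u w.
Proof. by rewrite dotpC dotpDl !(dotpC u). Qed.

Lemma dotpBr u v w : dotp u (v - w) = dotp u v - dotp u w.
Proof. by rewrite dotpDr -(scaleN1r w) [X in _ + X]dotpC dotpZl mulN1r (dotpC w). Qed.

Lemma l2norm_sqr v : l2norm v ^+ 2 = dotp v v.
Proof.
by rewrite dotpE sqr_sqrtr ?sumr_ge0// => i _; rewrite sqr_ge0.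
Qed.

Lemma l2norm0 : l2norm (0 : 'cV[R]_n) = 0.
Proof. by rewrite /l2norm big1 ?sqrtr0// => i _; rewrite mxE expr0n. Qed.

Lemma l2norm_gt0 v : v <> 0 -> 0 < l2norm v.
Proof.
move=> v0; rewrite sqrtr_gt0 lt0r sumr_ge0 ?andbT; last first.
  by move=> i _; rewrite sqr_ge0.
apply/negP; rewrite psumr_eq0; last by move=> i _; rewrite sqr_ge0.
move=> /allP vi0; apply: v0; apply/matrixP => i k; rewrite ord1 mxE.
by apply/eqP; rewrite -sqrf_eq0; exact: (implyP (vi0 i (mem_index_enum i))).
Qed.

End InnerProduct.

Lemma ler_mx_norm (R : realDomainType) (m n : nat) (M : 'M[R]_(m, n)) i k :
  `|M i k| <= mx_norm M.
Proof.
rewrite mx_normrE.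
exact: (le_bigmax _ (fun ij : 'I_m * 'I_n => `|M ij.1 ij.2|) (i, k)).
Qed.

Lemma trmx_mul_col (R : realType) (n p : nat) (X : 'M[R]_(n, p))
    (r : 'cV[R]_n) i : (X^T *m r) i 0 = dotp r (col i X).
Proof. by rewrite dotpC /dotp tr_col -row_mul [RHS]mxE. Qed.

Lemma dotp_col_le_norm (R : realType) (n p : nat) (X : 'M[R]_(n, p))
    (r : 'cV[R]_n) i : `|dotp r (col i X)| <= `|X^T *m r|.
Proof. by rewrite -trmx_mul_col; exact: ler_mx_norm. Qed.

Lemma norm_trmx_mul_argmax (R : realType) (n p : nat) (X : 'M[R]_(n, p))
    (r : 'cV[R]_n) (j : 'I_p)
    (jmax : forall i, `|dotp r (col i X)| <= `|dotp r (col j X)|) :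
  `|X^T *m r| = `|dotp r (col j X)|.
Proof.
apply/eqP; rewrite eq_le dotp_col_le_norm andbT.
rewrite [leLHS]mx_normrE; apply: bigmax_le => // -[i k] _ /=.
by rewrite ord1 trmx_mul_col.
Qed.

Section Subgradients.
Variables (R : realType) (n : nat) (P : set 'cV[R]_n).
Implicit Types (f : 'cV[R]_n -> R) (x y : 'cV[R]_n).

Lemma subdifferentialD f1 f2 x g1 g2 :
  subdifferential f1 P x g1 -> subdifferential f2 P x g2 ->
  subdifferential (fun z => f1 z + f2 z) P x (g1 + g2).
Proof.
move=> sub1 sub2 z Pz; rewrite dotpDl addrACA.
by apply: lerD; [exact: sub1 | exact: sub2].
Qed.

(** At [z] the right-hand side of the subgradient inequality is
    [s X_j^T z] with [s] the sign of [X_j^T x]: the constant terms cancel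
    exactly because [j] attains the maximum at [x]. *)
Lemma subgradient_max_correlation (p : nat) (X : 'M[R]_(n, p)) x (j : 'I_p) :
  (forall i, `|dotp x (col i X)| <= `|dotp x (col j X)|) ->
  subdifferential (fun z => `|X^T *m z|) P x
    (Num.sg (dotp x (col j X)) *: col j X).
Proof.
move=> /norm_trmx_mul_argmax normE z _.
rewrite normE dotpZl dotpBr !(dotpC (col j X)) normrEsg mulrBr addrC subrK.
apply: le_trans (dotp_col_le_norm X z j).
apply: le_trans (ler_norm _) _; rewrite normrM normr_sg.
by case: (dotp x (col j X) != 0); rewrite ?mul1r ?mul0r.
Qed.

(** The gap in the subgradient inequality is exactly [c * l2norm (z - x) ^+ 2],
    by expanding the square of [z - y = (x - y) + (z - x)]. *)
Lemma subgradient_sqr_dist c y x : 0 <= c ->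
  subdifferential (fun z => c * l2norm (z - y) ^+ 2) P x ((2 * c) *: (x - y)).
Proof.
move=> c_ge0 z _.
have -> : z - y = (x - y) + (z - x) by rewrite [RHS]addrC addrA subrK.
move: (x - y) (z - x) => u v.
rewrite !l2norm_sqr dotpZl !dotpDl !dotpDr (dotpC v u).
have : 0 <= c * dotp v v by rewrite -l2norm_sqr mulr_ge0 ?sqr_ge0.
lra.
Qed.

Lemma is_proj_id x : P x -> is_proj P x x.
Proof.
move=> Px; split=> // w _ wx; rewrite subrr l2norm0; apply: l2norm_gt0.
by move=> /subr0_eq/esym.
Qed.

End Subgradients.

(** Both recursions contract by [1 - eps / delta], the one for [r] around [y],
    the one for [beta] around [0], and the increments [- eps s X_(j k)] and
    [eps s e_(j k)] correspond because [X e_(j k) = X_(j k)]. *)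
Lemma RFS_residual (R : realType) (n p : nat) (X : 'M[R]_(n, p))
    (y : 'cV[R]_n) (eps delta : R) r beta j :
  RFS_run X y eps delta r beta j -> forall k, r k = y - X *m beta k.
Proof.
move=> run; elim=> [|k IHk].
  by rewrite (RFS_r0 run) (RFS_beta0 run) mulmx0 subr0.
rewrite (RFS_rS run) (RFS_betaS run) mulmxDr -!scalemxAr -colE.
move: (Num.sg _) => s; rewrite IHk; apply/matrixP => i l; rewrite !mxE.
ring.
Qed.

Theorem proposition4p1 (R : realType) (n p : nat)
    (X : 'M[R]_(n, p)) (y : 'cV[R]_n) (eps delta : R)
    (X_mean : forall i : 'I_p, vmean (col i X) = 0)
    (X_norm : forall i : 'I_p, l2norm (col i X) = 1)
    (y_mean : vmean y = 0)
    (eps_gt0 : 0 < eps) (delta_gt0 : 0 < delta) (eps_le_delta : eps <= delta)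
    (r : nat -> 'cV[R]_n) (beta : nat -> 'cV[R]_p) (j : nat -> 'I_p)
    (run : RFS_run X y eps delta r beta j) :
  subgradient_descent (RCM_obj X y delta) (P_res X y) (fun=> eps) y r.
Proof.
split; first exact: RFS_r0 run.
move=> k; exists (Num.sg (dotp (r k) (col (j k) X)) *: col (j k) X
                  + delta^-1 *: (r k - y)).
  apply: subdifferentialD.
    exact/subgradient_max_correlation/(RFS_argmax run).
  have -> : delta^-1 = 2 * (2 * delta)^-1 by field; rewrite gt_eqF.
  by apply: subgradient_sqr_dist; rewrite invr_ge0 mulr_ge0 // ltW.
rewrite -(RFS_rS run); apply: is_proj_id.
by exists (beta k.+1); exact: RFS_residual run k.+1.
Qed.
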